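(* Let $\mathcal{L}$ be a non-trivial finite atomistic lattice. Let $A, B \subseteq \mathrm{At}(\mathcal{L})$ be sets with $A \cup B= \mathrm{At}(\mathcal{L})$. For all $x \in \mathcal{L}$ we have $$\mu_{\mathcal{L}}(x) = \sum_{\substack{x_A \in \mathcal{L}(A), \ x_B \in \mathcal{L}(B) \\ (x_B)^{A}=0 \\ x_A \vee x_B =x}} \mu_{A}(x_A) \, \mu_{B}(x_B).$$
   Context: A lattice is non-trivial if it has more than one element. $\mathrm{At}(\mathcal{L})$ is the set of atoms of $\mathcal{L}$; $\mathcal{L}$ is atomistic if every nonzero element is a join of atoms (no gradedness is assumed). For a possibly empty $A\subseteq\mathrm{At}(\mathcal{L})$, $\mathcal{L}(A)$ is the set of elements of $\mathcal{L}$ that are joins (in $\mathcal{L}$) of some elements of $A$, together with $0\in\mathcal{L}$, with the order induced by $\mathcal{L}$ (it is a lattice). $\mu_{\mathcal{L}}$ and $\mu_A$ denote the Möbius functions of $\mathcal{L}$ and $\mathcal{L}(A)$, and $\mu_{\mathcal{L}}(x)=\mu_{\mathcal{L}}(0,x)$, $\mu_A(x)=\mu_A(0,x)$. Joins $\vee$ are taken in $\mathcal{L}$. For $y\in\mathcal{L}$, $y^A=\bigvee(\{a\in A\mid a\le y\}\cup\{0\})$, the largest element of $\mathcal{L}(A)$ that is $\le y$. *)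

(* Defs.v *)
From HB Require Import structures.
From mathcomp Require Import all_boot all_order all_algebra.

Set Implicit Arguments.
Unset Strict Implicit.
Unset Printing Implicit Defensive.

Import Order.TTheory GRing.Theory.

Local Open Scope order_scope.

Section Mobius.
Context {d : Order.disp_t} {P : finPOrderType d}.
Implicit Types x y z : P.

(* The recursion mu(x,x) = 1, mu(x,y) = - \sum_(x <= z < y) mu(x,z) with a fuel
   argument; #|P| bounds the length of every chain of P, so the fuel never runs
   out: see mobiusE. In particular mobius x y = 0 unless x <= y. *)
Fixpoint mobius_rec (n : nat) (x y : P) : int :=
  if n is n'.+1 then
    if x == y then 1%R
    else (- \sum_(z : P | (x <= z < y)%O) mobius_rec n' x z)%R
  else 0%R.

Definition mobius (x y : P) : int := mobius_rec #|P| x y.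

Let below y : nat := #|[set z | z < y]|.

Let below_lt y z : z < y -> (below z < below y)%N.
Proof.
move=> lt_zy; apply: proper_card; apply/properP; split.
  by apply/subsetP=> t; rewrite !inE => /lt_trans; apply.
by exists z; rewrite !inE // ltxx.
Qed.

Let below_card y : (below y < #|P|)%N.
Proof.
rewrite -cardsT; apply: proper_card; rewrite properT.
by apply/eqP=> /setP/(_ y); rewrite !inE ltxx.
Qed.

Let mobius_rec_fuel n m x y :
  (below y < n)%N -> (below y < m)%N -> mobius_rec n x y = mobius_rec m x y.
Proof.
elim: n m y => [//|n IHn] [//|m] y ltn ltm /=.
case: eqP => // _; congr (- _)%R; apply: eq_bigr => z /andP[_ /below_lt ltz].
by apply: IHn; rewrite (leq_trans ltz).
Qed.

Lemma mobiusE x y :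
  mobius x y =
    if x == y then 1%R else (- \sum_(z : P | (x <= z < y)%O) mobius x z)%R.
Proof.
have -> : mobius x y = mobius_rec #|P|.+1 x y.
  by apply: mobius_rec_fuel; rewrite ?ltnS ?below_card // ltnW // below_card.
by [].
Qed.

End Mobius.

Definition mobius0 {d : Order.disp_t} {P : finBPOrderType d} (x : P) : int :=
  mobius \bot x.

Section Atoms.
Context {d : Order.disp_t} {L : finTBLatticeType d}.
Implicit Types A S : {set L}.

Definition atoms : {set L} :=
  [set a | (\bot < a) && [forall y : L, ~~ (\bot < y < a)]].

Definition atomistic : Prop :=
  forall x : L, x != \bot ->
    exists2 S : {set L}, S \subset atoms & x = \join_(a in S) a.

(* S = set0 gives the empty join \bot. *)
Definition joins_of A : {set L} :=
  [set \join_(a in S) a | S : {set L} in powerset A].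

Lemma joins_of_bot A : \bot \in joins_of A.
Proof.
by apply/imsetP; exists set0; rewrite ?inE ?sub0set // big_set0.
Qed.

Definition proj (A : {set L}) (y : L) : L := \join_(a in A | a <= y) a.

Lemma proj_joins_of A y : proj A y \in joins_of A.
Proof.
apply/imsetP; exists [set a in A | a <= y].
  by rewrite inE; apply/subsetP=> a; rewrite inE => /andP[].
by rewrite /proj; apply: eq_bigl => a; rewrite inE.
Qed.

Lemma proj_le A y : proj A y <= y.
Proof. by apply/joinsP => a /andP[]. Qed.

Lemma proj_max A y z : z \in joins_of A -> z <= y -> z <= proj A y.
Proof.
case/imsetP=> S; rewrite inE => /subsetP sSA -> le_Sy.
apply/joinsP => a aS; apply: joins_sup; rewrite sSA //=.
by apply: le_trans le_Sy; apply: joins_sup.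
Qed.

Record joinlat A := JoinLat { jval :> L; _ : jval \in joins_of A }.

HB.instance Definition _ A := [isSub for @jval A].
HB.instance Definition _ A := [Finite of joinlat A by <:].
HB.instance Definition _ A := [SubChoice_isSubPOrder of joinlat A by <: with d].

Definition jbot A : joinlat A := JoinLat (joins_of_bot A).

Fact jbot_le A (x : joinlat A) : jbot A <= x.
Proof. by rewrite -Order.le_val le0x. Qed.

HB.instance Definition _ A :=
  Order.hasBottom.Build d (joinlat A) (@jbot_le A).

End Atoms.

Arguments atoms {d} L.
Arguments atomistic {d} L.

(* Main.v *)
Require Import Defs.
From mathcomp Require Import all_boot all_order all_algebra.

Import Order.TTheory GRing.Theory.

(** The values [mu(0, x)] are the only integers whose sum over each principal
    ideal [{x | x <= y}] is [1] if [y = 0] and [0] otherwise, so it is enough to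
    check that the right-hand side, summed over all [x <= y], has this property
    (mobius0_unique).

    Since [x_A \/ x_B <= y] means that [x_A <= y] and [x_B <= y], that sum is a
    product: the sum of [mu_A(x_A)] over all [x_A <= y], times the sum of
    [mu_B(x_B)] over the [x_B <= y] with [(x_B)^A = 0].  The elements of [L(A)]
    below [y] are those below [y^A], so the first factor is [1] if [y^A = 0] and
    [0] otherwise.  When [y^A = 0], every [x_B <= y] satisfies [(x_B)^A = 0], so
    the side condition disappears and the second factor is, in the same way, [1]
    if [y^B = 0] and [0] otherwise.  Finally [y^A = y^B = 0] says that no atom
    of [A] or [B], that is no atom at all, lies below [y]; as the lattice is
    atomistic, this happens exactly for [y = 0] (proj_cover_eq0). *)

Section MobiusSums.
Local Open Scope ring_scope.
Context {d : Order.disp_t} {P : finBPOrderType d}.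
Implicit Types (x y : P) (f : P -> int).

Lemma big_le_lt f y :
  \sum_(x | (x <= y)%O) f x = f y + \sum_(x | (x < y)%O) f x.
Proof.
rewrite (bigD1 y) //=; congr (_ + _).
by apply: eq_bigl => x; rewrite lt_neqAle andbC.
Qed.

Lemma sum_mobius0 y : \sum_(x | (x <= y)%O) mobius0 x = (y == \bot)%O%:R.
Proof.
rewrite big_le_lt /mobius0 mobiusE eq_sym; case: eqP => [->|_].
  by rewrite big_pred0 ?addr0 // => x; rewrite ltx0.
rewrite (eq_bigl (fun z => (z < y)%O)) ?addNr // => z.
by rewrite le0x.
Qed.

(** Both functions solve the same triangular system of equations, in which the
    value at [y] is determined by the values strictly below [y]. *)
Lemma mobius0_unique f :
    (forall y, \sum_(x | (x <= y)%O) f x = (y == \bot)%O%:R) ->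
  forall y, mobius0 y = f y.
Proof.
move=> sum_f y.
have [n] := ubnP #|[set z | (z < y)%O]|.
elim: n y => // n IHn y /ltnSE le_n.
have := sum_f y; rewrite -sum_mobius0 !big_le_lt.
rewrite [in RHS](eq_bigr f) => [/addIr-> // | x lt_xy].
apply: IHn; apply: leq_trans le_n; apply: proper_card; apply/properP; split.
  by apply/subsetP => z; rewrite !inE => /lt_trans; apply.
by exists x; rewrite !inE // ltxx.
Qed.

End MobiusSums.

Section AtomSets.
Local Open Scope order_scope.
Context {d : Order.disp_t} {L : finTBLatticeType d}.
Implicit Types (A B : {set L}) (y z : L).

Lemma proj_eq0_le A y z : z <= y -> proj A y = \bot -> proj A z = \bot.
Proof.
move=> le_zy Ay0; apply/eqP; rewrite -lex0 -Ay0.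
by apply: proj_max (proj_joins_of A z) (le_trans (proj_le A z) le_zy).
Qed.

(** The elements of [L(A)] below [y], which need not itself lie in [L(A)], form
    the principal ideal of [L(A)] generated by [y^A]. *)
Lemma sum_mobius0_joinlat A y :
  (\sum_(xA : joinlat A | (jval xA <= y)%O) mobius0 xA)%R
    = ((proj A y == \bot)%O%:R)%R.
Proof.
pose yA : joinlat A := JoinLat (proj_joins_of A y).
transitivity ((yA == \bot)%O%:R : int)%R; last by rewrite -val_eqE.
rewrite -sum_mobius0; apply: eq_bigl => xA; rewrite -Order.le_val /=.
apply/idP/idP => [|/le_trans]; last by apply; apply: proj_le.
by apply: proj_max; apply: valP.
Qed.

Lemma proj_cover_eq0 A B y :
    atomistic L -> A :|: B = atoms L ->
  (proj A y == \bot) && (proj B y == \bot) = (y == \bot).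
Proof.
move=> atomL AB; apply/andP/eqP => [[/eqP Ay0 /eqP By0]|->]; last first.
  by rewrite -!lex0 !proj_le.
have [//|/atomL[S /subsetP S_atoms yS]] := eqVneq y \bot.
apply/eqP; rewrite -lex0 {1}yS; apply/joinsP => a aS.
have le_ay : a <= y by rewrite yS; apply: joins_sup.
have := S_atoms a aS; rewrite -AB => /setUP[aA|aB].
  by rewrite -Ay0; apply: joins_sup; rewrite aA.
by rewrite -By0; apply: joins_sup; rewrite aB.
Qed.

End AtomSets.

Theorem theorem2p5 (d : Order.disp_t) (L : finTBLatticeType d)
    (L_nontrivial : (1 < #|L|)%N) (L_atomistic : atomistic L)
    (A B : {set L}) (A_atoms : A \subset atoms L) (B_atoms : B \subset atoms L)
    (AB_atoms : A :|: B = atoms L) (x : L) :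
  mobius0 x =
    (\sum_(xA : joinlat A) \sum_(xB : joinlat B |
        (proj A (jval xB) == \bot)%O && (Order.join (jval xA) (jval xB) == x))
      mobius0 xA * mobius0 xB)%R.
Proof.
move: x; apply: mobius0_unique => y.
(* Grouping the pairs by their join turns the sum over x <= y into a sum over
   the pairs of elements of the two ideals below y. *)
transitivity (\sum_(xA : joinlat A | (jval xA <= y)%O)
    \sum_(xB : joinlat B | (proj A (jval xB) == \bot)%O && (jval xB <= y)%O)
      mobius0 xA * mobius0 xB)%R.
  rewrite exchange_big [RHS]big_mkcond /=; apply: eq_bigr => xA _.
  transitivity (\sum_(xB : joinlat B | (proj A (jval xB) == \bot)%O
      && (Order.join (jval xA) (jval xB) <= y)%O) mobius0 xA * mobius0 xB)%R.
    rewrite (exchange_big_dep (fun xB => proj A (jval xB) == \bot)%O) /=;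
      last by move=> z xB _ /andP[].
    rewrite [RHS]big_mkcondr; apply: eq_bigr => xB AxB0.
    rewrite (eq_bigl (fun z => (z == Order.join (jval xA) (jval xB))
                               && (z <= y)%O)); last first.
      by move=> z; rewrite AxB0 /= andbC eq_sym.
    by rewrite big_mkcondr big_pred1_eq.
  case: ifP => le_xAy; first by apply: eq_bigl => xB; rewrite leUx le_xAy.
  by rewrite big_pred0 // => xB; rewrite leUx le_xAy andbF.
rewrite -big_distrlr /= sum_mobius0_joinlat -(proj_cover_eq0 A B y) //.
case: eqP => [Ay0|_] /=; last by rewrite mul0r.
rewrite mul1r -sum_mobius0_joinlat; apply: eq_bigl => xB.
apply: andb_idl => le_xBy; apply/eqP; exact: proj_eq0_le Ay0.
Qed.
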